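(* Let $d\ge 1$ and let $\mathbb{Z}^d$ be equipped with a connection $\mathcal{C}$ satisfying conditions (C1)–(C3) of the context. Then for any $n\in\mathbb{N}$ the operators $L_n$ and $U_n$ on $\mathcal{A}(\mathbb{Z}^d)$ are separators.
   Context: $\mathbb{N}=\{1,2,\dots\}$. $\mathcal{A}(\mathbb{Z}^d)$ is the vector lattice of all functions $f:\mathbb{Z}^d\to\mathbb{R}$ with pointwise operations and order. A connection on a non-empty set $B$ is a family $\mathcal{C}$ of subsets of $B$ such that (i) $\emptyset\in\mathcal{C}$; (ii) $\{x\}\in\mathcal{C}$ for all $x\in B$; (iii) for any family $\{C_i:i\in I\}\subseteq\mathcal{C}$, $\bigcap_{i\in I} C_i\neq\emptyset$ implies $\bigcup_{i\in I} C_i\in\mathcal{C}$. Members of $\mathcal{C}$ are called connected sets. Standing assumptions on the connection $\mathcal{C}$ on $\mathbb{Z}^d$: (C1) $\mathbb{Z}^d\in\mathcal{C}$; (C2) for every $C\in\mathcal{C}$ and $a\in\mathbb{Z}^d$, the translate $\{x+a:x\in C\}$ is in $\mathcal{C}$; (C3) if $V\subsetneq W$ with $V,W\in\mathcal{C}$, then there exists $x\in W\setminus V$ with $V\cup\{x\}\in\mathcal{C}$. For $x\in\mathbb{Z}^d$ and $n\in\mathbb{N}$ let $\mathcal{N}_n(x)=\{V\in\mathcal{C}: x\in V,\ \mathrm{card}(V)=n+1\}$. For $f\in\mathcal{A}(\mathbb{Z}^d)$: $$L_n(f)(x)=\max_{V\in\mathcal{N}_n(x)}\min_{y\in V}f(y),\qquad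 U_n(f)(x)=\min_{V\in\mathcal{N}_n(x)}\max_{y\in V}f(y).$$ For $a\in\mathbb{Z}^d$ the shift operator is $E_a(f)(x)=f(x+a)$. An operator $P:\mathcal{A}(\mathbb{Z}^d)\to\mathcal{A}(\mathbb{Z}^d)$ (not necessarily linear) is a separator if (i) $P\circ E_a=E_a\circ P$ for all $a\in\mathbb{Z}^d$; (ii) $P(f+c)=P(f)+c$ for all $f$ and all constant functions $c$; (iii) $P(\alpha f)=\alpha P(f)$ for all real $\alpha\ge 0$ and all $f$; (iv) $P\circ P=P$; (v) $(id-P)\circ(id-P)=id-P$, where $id$ is the identity operator and $(id-P)(f)=f-P(f)$.
   Formalization: The outer maximum in L_n and outer minimum in U_n over N_n(x) are read as supremum and infimum, since N_n(x) may be infinite and the maximum or minimum need not be attained; they agree whenever the maximum or minimum exists. *)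

(* Defs.v *)
From HB Require Import structures.
From mathcomp Require Import all_boot all_order all_algebra finmap.
From mathcomp Require Import all_classical all_reals.

Set Implicit Arguments.
Unset Strict Implicit.
Unset Printing Implicit Defensive.

Import Order.TTheory GRing.Theory Num.Theory.

Local Open Scope classical_set_scope.
Local Open Scope ring_scope.

Notation array R d := ('rV[int]_d -> R).

Record is_connection (T : Type) (C : set (set T)) : Prop := {
  connection_carrier : [set: T] !=set0 ;
  connection_empty : C set0 ;
  connection_point : forall x, C [set x] ;
  connection_bigcup : forall F : set (set T), F `<=` C ->
    \bigcap_(V in F) V !=set0 -> C (\bigcup_(V in F) V) }.

Record grid_connection (d : nat) (C : set (set 'rV[int]_d)) : Prop := {
  grid_is_connection : is_connection C ;
  grid_whole : C setT ;
  grid_translate : forall V a, C V -> C [set x + a | x in V] ;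
  grid_grow : forall V W, C V -> C W -> V `<` W ->
    exists2 x, (W `\` V) x & C (V `|` [set x]) }.

Definition nbhd (d : nat) (C : set (set 'rV[int]_d)) (n : nat)
    (x : 'rV[int]_d) : set (set 'rV[int]_d) :=
  [set V | [/\ C V, V x & (V #= `I_n.+1)%card]].

(* The seed [f x] of the iterated minimum (maximum) is one of the values being
   compared, since x belongs to V.  A connection may have infinitely many
   members of [nbhd C n x], and the maximum (minimum) over them need not be
   attained, so it is read as a supremum (infimum).  It is that of a nonempty
   family, by [grid_whole] and [grid_grow], bounded by [f x], and it is the
   maximum (minimum) whenever the latter exists. *)
Definition L_op (R : realType) (d : nat) (C : set (set 'rV[int]_d)) (n : nat)
    (f : array R d) : array R d :=
  fun x => sup [set \big[Num.min/f x]_(y <- fset_set V) f y | V in nbhd C n x].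

Definition U_op (R : realType) (d : nat) (C : set (set 'rV[int]_d)) (n : nat)
    (f : array R d) : array R d :=
  fun x => inf [set \big[Num.max/f x]_(y <- fset_set V) f y | V in nbhd C n x].

Definition shift_op (R : realType) (d : nat) (a : 'rV[int]_d)
    (f : array R d) : array R d := fun x => f (x + a).

Definition residual (R : realType) (d : nat) (P : array R d -> array R d)
    (f : array R d) : array R d := f \- P f.

Record separator (R : realType) (d : nat) (P : array R d -> array R d) : Prop := {
  separator_shift : forall a, P \o shift_op a = shift_op a \o P ;
  separator_addc : forall f (c : R), P (f \+ cst c) = P f \+ cst c ;
  separator_scale : forall (alpha : R) f, 0 <= alpha ->
    P (alpha \*o f) = alpha \*o P f ;
  separator_idem : P \o P = P ;
  separator_coidem : residual P \o residual P = residual P }.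

(* Main.v *)
(* For V in nbhd C n x, every y in V has V in nbhd C n y as well, so that
   [L_op C n f] is at least the minimum of f on V at every point of V.
   Idempotence follows at once; and at a point of V where f attains its minimum
   on V, [L_op C n f] equals f, so the nonnegative function [f - L_op C n f]
   vanishes somewhere on each V and [L_op C n] maps it to 0.  The claim for
   [U_op] is dual, since [U_op C n f = - L_op C n (- f)]. *)
Require Import Defs.
From mathcomp Require Import all_boot all_order all_algebra finmap.
From mathcomp Require Import all_classical all_reals.
From mathcomp Require Import unstable.

Import Order.TTheory GRing.Theory Num.Theory.

Local Open Scope classical_set_scope.
Local Open Scope ring_scope.

(** The absolute value of an entry maps the constant vectors onto the natural numbers; with [d = 0]
    there is no entry and the grid is a single point. *)
Lemma infinite_grid (d : nat) : (0 < d)%N -> infinite_set [set: 'rV[int]_d].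
Proof.
case: d => // d _ fin; apply: infinite_nat.
apply: (sub_finite_set _ (finite_image (fun v : 'rV[int]_d.+1 => absz (v 0 0)) fin)).
by move=> k _; exists (const_mx k%:Z) => //; rewrite mxE.
Qed.

Lemma card_eqU1 (T : Type) (A : set T) (x : T) (n : nat) :
  ~ A x -> (A #= `I_n)%card -> (A `|` [set x] #= `I_n.+1)%card.
Proof.
move=> Ax An; apply/eq_cardSP; exists x; first by right.
rewrite setDUl setDv setU0 (_ : A `\ x = A) //.
by apply/seteqP; split=> [y []//|y Ay]; split=> // xy; apply: Ax; rewrite -xy.
Qed.

Section Neighborhoods.
Context {d : nat} {C : set (set 'rV[int]_d)} (hC : grid_connection C).
Implicit Types (x a : 'rV[int]_d) (V : set 'rV[int]_d).

Lemma nbhd_finite {n x V} : nbhd C n x V -> finite_set V.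
Proof. by case=> _ _ Vn; apply/finite_setP; exists n.+1. Qed.

Lemma nbhd_center {n x y V} : nbhd C n x V -> V y -> nbhd C n y V.
Proof. by case=> CV _ Vn Vy. Qed.

(** Start from [[set x]] and add one point at a time by [grid_grow] inside the whole grid, which a
    finite set never exhausts. This keeps the supremum in [L_op] away from the default value of
    [sup] on the empty set. *)
Lemma nbhd_nonempty (n : nat) x : (0 < d)%N -> nbhd C n x !=set0.
Proof.
move=> d_gt0; elim: n => [|n [V nV]].
  exists [set x]; split => //; last exact: card_set1.
  exact: connection_point (grid_is_connection hC) x.
have VT : V `<` setT.
  split=> // TV; apply: (infinite_grid d d_gt0).
  exact: sub_finite_set TV (nbhd_finite nV).
have [CV Vx Vn] := nV.
have [y [_ Vy] CVy] := grid_grow hC CV (grid_whole hC) VT.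
by exists (V `|` [set y]); split=> //; [left | exact: card_eqU1].
Qed.

Lemma nbhd_translate {n x V} a :
  nbhd C n x V -> nbhd C n (x + a) [set y + a | y in V].
Proof.
move=> [CV Vx Vn]; split; [exact: grid_translate | by exists x | ].
by apply: card_eq_trans Vn; apply: inj_card_eq => u v _ _; apply: addIr.
Qed.

Context {R : realType}.
Implicit Type f : array R d.

(** The seed [f x] adds no constraint, because [x] lies in [V]. *)
Lemma le_nbhd_bigmin {n x V} f (c : R) : nbhd C n x V ->
  (c <= \big[Num.min/f x]_(y <- fset_set V) f y) <->
  (forall y, V y -> c <= f y).
Proof.
move=> nV; have finV := nbhd_finite nV; have [_ Vx _] := nV.
split=> [le_c y Vy|le_c].
  by apply: le_trans le_c _; apply: ge_bigmin_seq; rewrite // in_fset_set ?inE.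
rewrite big_seq; apply: le_bigmin => [|y]; first exact: le_c.
by rewrite in_fset_set // inE; apply: le_c.
Qed.

Lemma le_L_op {n x V} f (c : R) : nbhd C n x V ->
  (forall y, V y -> c <= f y) -> c <= L_op C n f x.
Proof.
move=> nV /(le_nbhd_bigmin f c nV)/le_trans; apply.
apply: ub_le_sup; last by exists V.
by exists (f x) => _ [W _ <-]; apply: bigmin_le_id.
Qed.

Lemma L_op_le n f x : (0 < d)%N -> L_op C n f x <= f x.
Proof.
move=> d_gt0; apply: ge_sup => [|_ [W _ <-]]; last exact: bigmin_le_id.
exact: image_nonempty (nbhd_nonempty n x d_gt0).
Qed.

Lemma lt_L_op n f x (c : R) : (0 < d)%N -> c < L_op C n f x ->
  exists2 V, nbhd C n x V & forall y, V y -> c <= f y.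
Proof.
move=> d_gt0 /sup_gt[|_ [V nV <-] /ltW].
  exact: image_nonempty (nbhd_nonempty n x d_gt0).
by move/(le_nbhd_bigmin f c nV) => Vc; exists V.
Qed.

(** A description of the supremum by its lower bounds, through which each separator law becomes a
    search for sets [V]. The first premise is limited to [c < l] because the supremum need not be
    attained. *)
Lemma L_op_eq n f x (l : R) : (0 < d)%N ->
  (forall c, c < l -> exists2 V, nbhd C n x V & forall y, V y -> c <= f y) ->
  (forall c V, nbhd C n x V -> (forall y, V y -> c <= f y) -> c <= l) ->
  L_op C n f x = l.
Proof.
move=> d_gt0 lb ub; apply/eqP; rewrite eq_le; apply/andP; split.
  apply/ler_ltP => c /(lt_L_op _ _ _ _ d_gt0)[V nV Vc]; exact: ub nV Vc.
by apply/ler_ltP => c /lb[V nV Vc]; apply: le_L_op nV Vc.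
Qed.

Lemma U_opE n f x : U_op C n f x = - L_op C n (\- f) x.
Proof.
rewrite /U_op /L_op /inf image_comp; congr (- sup _).
apply: eq_imagel => V _ /=.
by elim/big_rec2: _ => // y a b _ <-; rewrite oppr_max.
Qed.

Lemma L_op_separator n : (0 < d)%N -> separator (L_op (R := R) C n).
Proof.
move=> d_gt0; split.
- move=> a; apply/funext => f; apply/funext => x /=; rewrite /shift_op.
  (* Translation by [a] carries neighborhoods of [x] to those of [x + a], and translation by [- a]
     carries them back. *)
  apply: L_op_eq => // [c /lt_L_op[//|V nV Vc]|c V nV Vc].
    exists [set y - a | y in V]; last by move=> _ [y Vy <-]; rewrite subrK; apply: Vc.
    by have := nbhd_translate (- a) nV; rewrite addrK.
  by apply: (le_L_op _ _ (nbhd_translate a nV)) => _ [y Vy <-]; apply: Vc.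
- move=> f k; apply/funext => x /=.
  apply: L_op_eq => // [c|c V nV Vc].
    rewrite -ltrBlDr => /lt_L_op[//|V nV Vc]; exists V => // y /Vc /=.
    by rewrite lerBlDr.
  by rewrite -lerBlDr; apply: le_L_op nV _ => y /Vc /=; rewrite lerBlDr.
(* The factor 0 is treated apart, since the general case divides by [k]. *)
- move=> k f; rewrite le_eqVlt => /predU1P[<-|k_gt0]; apply/funext => x /=.
    rewrite mul0r; apply: L_op_eq => // [c c_lt0|c V [_ Vx _] /(_ _ Vx)] /=.
      have [V nV] := nbhd_nonempty n x d_gt0; exists V => // y _ /=.
      by rewrite mul0r ltW.
    by rewrite mul0r.
  apply: L_op_eq => // [c|c V nV Vc].
    rewrite -ltr_pdivrMl // => /lt_L_op[//|V nV Vc]; exists V => // y /Vc /=.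
    by rewrite ler_pdivrMl.
  by rewrite -ler_pdivrMl //; apply: le_L_op nV _ => y /Vc /=; rewrite ler_pdivrMl.
- apply/funext => f; apply/funext => x /=.
  apply: L_op_eq => // [c /lt_L_op[//|V nV Vc]|c V nV Vc].
    by exists V => // y Vy; apply: le_L_op (nbhd_center nV Vy) Vc.
  by apply: le_L_op nV _ => y /Vc /le_trans; apply; apply: L_op_le.
- apply/funext => f; apply/funext => x /=.
  (* It remains to show that [L_op C n] sends the residual of [f] to 0. The residual is nonnegative,
     so any neighborhood serves for the lower bound. *)
  rewrite /residual /= -[RHS]subr0; congr (_ - _).
  apply: L_op_eq => // [c c_lt0|c V nV Vc].
    have [V nV] := nbhd_nonempty n x d_gt0; exists V => // y _ /=.
    by rewrite (le_trans (ltW c_lt0)) // subr_ge0 L_op_le.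
  have [y Vy ymin] : exists2 y, V y & forall z, V z -> f y <= f z.
    have [_ Vx _] := nV; have finV := nbhd_finite nV.
    have xV : x \in fset_set V by rewrite in_fset_set ?inE.
    have [y _ ymin] := arg_minP (fun z : fset_set V => f (val z))
      (isT : xpredT [` xV]%fset).
    exists (val y); first by have := valP y; rewrite in_fset_set ?inE.
    move=> z Vz; have zV : z \in fset_set V by rewrite in_fset_set ?inE.
    exact: (ymin [` zV]%fset).
  (* At the minimum point [y] the set [V] itself gives [f y <= L_op C n f y], so the residual at [y]
     is at most 0. *)
  apply: le_trans (Vc _ Vy) _ => /=.
  by rewrite subr_le0; apply: le_L_op (nbhd_center nV Vy) ymin.
Qed.

End Neighborhoods.

(** Conjugation by negation respects composition and commutes with shifts and with nonnegative
    scaling; it only flips the sign of an added constant. *)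
Lemma separator_dual (R : realType) (d : nat) (P Q : array R d -> array R d) :
  (forall f, Q f = \- P (\- f)) -> separator P -> separator Q.
Proof.
move=> QE [Pshift Paddc Pscale Pidem Pcoidem].
have NN (f : array R d) : \- (\- f) = f by apply/funext => x /=; rewrite opprK.
have QP f : \- Q f = P (\- f) by rewrite QE NN.
(* The residuals are conjugate in the same way, so the last law transfers exactly as idempotence
   does. *)
have resQ f : residual Q f = \- residual P (\- f).
  by apply/funext => x; rewrite /residual QE /= opprB !opprK addrC.
split.
- move=> a; apply/funext => f /=; rewrite !QE.
  exact: (congr1 (fun F => \- F (\- f)) (Pshift a)).
- move=> f c; rewrite !QE.
  have -> : \- (f \+ cst c) = (\- f) \+ cst (- c).
    by apply/funext => x /=; rewrite opprD.
  by rewrite Paddc; apply/funext => x /=; rewrite opprD opprK.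
- move=> k f k_ge0; rewrite !QE.
  have -> : \- (k \*o f) = k \*o (\- f) by apply/funext => x /=; rewrite mulrN.
  by rewrite Pscale //; apply/funext => x /=; rewrite mulrN.
- apply/funext => f /=; rewrite QE QP QE.
  by have /= -> := congr1 (fun F => F (\- f)) Pidem.
- apply/funext => f /=; rewrite !resQ NN.
  by have /= -> := congr1 (fun F => F (\- f)) Pcoidem.
Qed.

Theorem theorem6 (R : realType) (d : nat) (hd : (1 <= d)%N)
    (C : set (set 'rV[int]_d)) (hC : grid_connection C)
    (n : nat) (hn : (1 <= n)%N) :
  separator (L_op (R := R) C n) /\ separator (U_op (R := R) C n).
Proof.
have LC := L_op_separator hC (R := R) n hd; split => //.
by apply: separator_dual LC => f; apply/funext => x; rewrite U_opE.
Qed.
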